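(* Let $K$ be a field, $S=K[x_0,\ldots,x_n]$ with $x_0<x_1<\cdots<x_n$, and let $J\subseteq S$ be a strongly stable monomial ideal. The $J$-marked scheme is homogeneous with respect to the (non-standard) grading $\lambda$ of $K[C]$ over the group $\mathbb Z^{n+1}$ given by $\lambda(C_{\alpha\gamma})=\alpha-\gamma$; that is, its defining ideal $\mathfrak A\subseteq K[C]$ is homogeneous with respect to $\lambda$.
   Context: A term is a monomial $x^\alpha=x_0^{\alpha_0}\cdots x_n^{\alpha_n}$, identified with its exponent $\alpha\in\mathbb Z^{n+1}$. A monomial ideal $J$ is strongly stable if for every term $x^\alpha\in J$ and all $0\le i<j\le n$ with $\alpha_i>0$, the term $x_j x^\alpha/x_i$ belongs to $J$. $B_J$ is the minimal set of monomial generators of $J$, $\mathcal N(J)_d$ is the set of terms of degree $d$ not in $J$, and $J_m$ is the degree-$m$ homogeneous part of $J$. For every $x^\alpha\in B_J$ let $F_\alpha:=x^\alpha-\sum_{x^\gamma\in\mathcal N(J)_{|\alpha|}}C_{\alpha\gamma}x^\gamma$, where the $C_{\alpha\gamma}$ are new variables; $C$ is the set of all these variables. For each $m$, let $A_m$ be the matrix whose columns correspond to the terms of degree $m$ in $S$ and whose rows correspond to all the polynomials of degree $m$ (in the $x_i$) of the form $x^\delta F_\alpha$, the row containing the coefficients of these terms in that polynomial. $\mathfrak A$ is the ideal of $K[C]$ generated by the minors of order $\dim_K J_m+1$ of $A_m$, for all $m$. The $J$-marked scheme is the affine scheme defined by $\mathfrak A$ (its $K$-points parametrize the homogeneous ideals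 $I$ such that the set of terms outside $J$ is a $K$-basis of $S/I$). *)

(* Defs.v *)
From HB Require Import structures.
From mathcomp Require Import all_boot all_order all_algebra.
From mathcomp Require Import finmap.
(* The notations of monalg clash with those of mpoly. *)
From mathcomp Require Import -(notations) monalg.
From mathcomp Require Import mpoly.

Set Implicit Arguments.
Unset Strict Implicit.
Unset Printing Implicit Defensive.

Import GRing.Theory.

Local Open Scope ring_scope.

Definition ideal_gen (R : comNzRingType) (E : R -> Prop) (p : R) : Prop :=
  exists s : seq (R * R),
    (forall u, u \in s -> E u.2) /\ p = \sum_(u <- s) u.1 * u.2.

Section MonomialIdeals.

Variables (K : fieldType) (n : nat).

Definition monomial_gen (E : 'X_{1..n.+1} -> Prop) : {mpoly K[n.+1]} -> Prop :=
  ideal_gen (fun q => exists2 a, E a & q = 'X_[a]).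

Definition monomial_ideal (J : {pred {mpoly K[n.+1]}}) : Prop :=
  exists E : 'X_{1..n.+1} -> Prop, forall p, p \in J <-> monomial_gen E p.

Implicit Type J : {pred {mpoly K[n.+1]}}.

(* The subtraction of exponents is truncated, hence harmless as 0 < a i. *)
Definition strongly_stable J : Prop :=
  monomial_ideal J /\
  forall (a : 'X_{1..n.+1}) (i j : 'I_n.+1),
    'X_[a] \in J -> (i < j)%N -> (0 < a i)%N -> 'X_[a - U_(i) + U_(j)] \in J.

(* The divisors of x^a have degree at most |a|, hence the bounded quantifier;
   in_mingen_gen and in_mingen_min show that these are the elements of the
   minimal monomial generating set of a monomial ideal. *)
Definition in_mingen J (a : 'X_{1..n.+1}) : bool :=
  ('X_[a] \in J) &&
  [forall b : 'X_{1..n.+1 < (mdeg a).+1},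
     ('X_[b] \in J) && (bmnm b <= a)%MM ==> (bmnm b == a)].

Definition mingen J : choiceType := {a : 'X_{1..n.+1} | in_mingen J a}.

Definition term (d : nat) : finType :=
  {b : 'X_{1..n.+1 < d.+1} | mdeg b == d}.

Definition term_mnm d (b : term d) : 'X_{1..n.+1} := bmnm (val b).

Definition nterm J (d : nat) : finType :=
  {b : term d | 'X_[term_mnm b] \notin J}.

Definition nterm_mnm J d (b : nterm J d) : 'X_{1..n.+1} := term_mnm (val b).

(* U is the degree-m homogeneous part of J; it exists by homog_part_ex. *)
Definition homog_part J (m : nat) (U : {vspace dhomog n.+1 K m}) : Prop :=
  forall p : dhomog n.+1 K m, p \in U = (mpoly_of_dhomog p \in J).

Lemma monomial_genP E p :
  monomial_gen E p <->
  forall m, m \in msupp p -> exists2 a, E a & (a <= m)%MM.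
Proof.
split=> [[s [sE ->]] m /msupp_sum_le /flattenP[_ /mapP[u us ->]] mu|pE].
  rewrite mem_filter /= in us; have [a Ea ua] := sE _ us.
  exists a => //; move: mu; rewrite ua => /msuppM_le /allpairsP[[b c] /=].
  by rewrite msuppX inE => -[_ /eqP-> ->]; apply: lem_addl.
have {pE}: forall s : seq 'X_{1..n.+1}, {subset s <= msupp p} ->
    monomial_gen E (\sum_(m <- s) p@_m *: 'X_[m]).
  elim=> [|m s IHs] sp; first by exists [::]; rewrite !big_nil.
  have [|t [tE tp]] := IHs; first by move=> b bs; apply: sp; rewrite inE bs orbT.
  have [a Ea am] := pE m (sp m (mem_head _ _)).
  exists ((p@_m *: 'X_[m - a], 'X_[a]) :: t); split=> [u|].
    by rewrite inE => /predU1P[->|/tE//]; exists a.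
  by rewrite !big_cons tp /= -scalerAl -mpolyXD submK.
by move/(_ (msupp p)); rewrite -mpolyE; apply.
Qed.

Lemma monomial_ideal_msupp J p : monomial_ideal J ->
  (p \in J) = all (fun m => 'X_[m] \in J) (msupp p).
Proof.
case=> E JE; have JX m : 'X_[m] \in J <-> exists2 a, E a & (a <= m)%MM.
  rewrite JE monomial_genP; split=> [|h b]; last by rewrite msuppX inE => /eqP->.
  by apply; rewrite msuppX mem_head.
apply/idP/allP => [/JE/monomial_genP h m /h/JX //|h].
by apply/JE/monomial_genP => m /h/JX.
Qed.

Lemma monomial_ideal_divX J a b :
  monomial_ideal J -> 'X_[a] \in J -> (a <= b)%MM -> 'X_[b] \in J.
Proof.
case=> E JE /JE/monomial_genP/(_ a); rewrite msuppX mem_head => /(_ isT)[c Ec ca].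
move=> ab; apply/JE/monomial_genP => m; rewrite msuppX inE => /eqP->.
by exists c => //; apply: lepm_trans ca ab.
Qed.

Lemma in_mingen_min J E a : (forall p, p \in J <-> monomial_gen E p) ->
  in_mingen J a -> E a.
Proof.
move=> JE /andP[/JE/monomial_genP/(_ a)].
rewrite msuppX mem_head => /(_ isT)[b Eb ba] /forallP.
have hb : (mdeg b < (mdeg a).+1)%N by rewrite ltnS lemc_mdeg ?lem_leo.
move/(_ (BMultinom hb)) => /=; rewrite ba andbT => /implyP h.
suff /h/eqP <- : 'X_[b] \in J by [].
apply/JE/monomial_genP => m; rewrite msuppX inE => /eqP->.
by exists b => //; apply: lepm_refl.
Qed.

Lemma in_mingen_gen J : monomial_ideal J ->
  forall p, p \in J <-> monomial_gen (in_mingen J) p.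
Proof.
move=> mJ p; rewrite (monomial_ideal_msupp p mJ) monomial_genP.
split=> [/allP h m /h {h}|h]; last first.
  by apply/allP => m /h[a /andP[aJ _] am]; apply: monomial_ideal_divX am.
have [d] := ubnP (mdeg m); elim: d m => // d IHd m; rewrite ltnS => md mJ'.
have [|] := boolP (in_mingen J m); first by exists m => //; apply: lepm_refl.
rewrite /in_mingen mJ' /= negb_forall => /existsP[b].
rewrite negb_imply => /andP[/andP[]].
move: (bmnm b) => {}b bJ bm nbm.
have [|//|a Ja ab] := IHd b; last by exists a => //; apply: lepm_trans bm.
apply: leq_trans md; rewrite ltn_neqAle lemc_mdeg ?lem_leo // andbT.
apply: contra nbm => /eqP e; move/(congr1 mdeg)/eqP: (submK bm).
rewrite mdegD e -{2}[mdeg m]add0n eqn_add2r mdeg_eq0 => /eqP z.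
by rewrite -(submK bm) z add0m.
Qed.

Lemma homog_part_ex J m : monomial_ideal J ->
  exists U : {vspace dhomog n.+1 K m}, homog_part J U.
Proof.
move=> mJ; pose mon (b : 'X_{1..n.+1 < m.+1}) : dhomog n.+1 K m :=
  indhomog m 'X_[bmnm b].
pose P (b : 'X_{1..n.+1 < m.+1}) := (mdeg b == m) && ('X_[bmnm b] \in J).
pose T := [seq mon b | b <- enum {: 'X_{1..n.+1 < m.+1}} & P b].
exists <<T>>%VS => p; apply/idP/idP => [/(@coord_span _ _ _ (in_tuple T)) pT|].
  rewrite (monomial_ideal_msupp _ mJ); apply/allP => a; rewrite pT raddf_sum /=.
  move=> /msupp_sum_le /flattenP[_ /mapP[i _ ->]] /msuppZ_le.
  have /mapP[b] := mem_nth 0 (ltn_ord i).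
  rewrite mem_filter => /andP[/andP[bm bJ] _] ->.
  by rewrite /mon insubdK ?[_ \is _]dhomogX // msuppX inE => /eqP->.
rewrite (monomial_ideal_msupp _ mJ) => /allP h.
have -> : p = \sum_(a <- msupp p) p@_a *: (indhomog m 'X_[a] : dhomog n.+1 K m).
  apply/val_inj; rewrite /= raddf_sum {1}[mpoly_of_dhomog p]mpolyE /=.
  apply: eq_big_seq => a ap; rewrite /= insubdK //.
  by rewrite [_ \is _]dhomogX (dhomog_mf (dhomog_is_dhomog p)).
rewrite big_seq; apply: memv_suml => a ap; apply/memvZ/memv_span.
have am : mdeg a = m by rewrite (dhomog_mf (dhomog_is_dhomog p)).
have ha : (mdeg a < m.+1)%N by rewrite am.
apply/mapP; exists (BMultinom ha) => //.
by rewrite mem_filter /P /= am eqxx h //= mem_enum.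
Qed.

Section MarkedScheme.

Variable J : {pred {mpoly K[n.+1]}}.

Definition Cvar : choiceType := {a : mingen J & nterm J (mdeg (val a))}.

Definition Cring : comNzRingType := malg (cmonom Cvar) K.

Definition Cgen (c : Cvar) : Cring := mkmalgU (ucm c) 1.

Definition marked (a : mingen J) : {mpoly Cring[n.+1]} :=
  'X_[val a] -
  \sum_(c : nterm J (mdeg (val a)))
     Cgen (Tagged (fun a => nterm J (mdeg (val a))) c) *: 'X_[nterm_mnm c].

(* The pairs (d, a) with a in the minimal generating set and |d| + |a| = m. *)
Definition marked_row (m : nat) : finType :=
  {u : 'X_{1..n.+1 < m.+1} * {a : 'X_{1..n.+1 < m.+1} | in_mingen J a} |
     mdeg u.1 + mdeg (val u.2) == m}%N.

Definition marked_row_poly m (u : marked_row m) : {mpoly Cring[n.+1]} :=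
  'X_[bmnm (val u).1] *
  marked (exist (in_mingen J) (bmnm (val (val u).2)) (valP (val u).2)).

Definition marked_mx (m : nat) : 'M[Cring]_(#|marked_row m|, #|term m|) :=
  \matrix_(i, j) (marked_row_poly (enum_val i))@_(term_mnm (enum_val j)).

Definition minor_of (R : comNzRingType) p q (A : 'M[R]_(p, q)) (r : nat)
    (x : R) : Prop :=
  exists (f : 'I_r -> 'I_p) (g : 'I_r -> 'I_q),
    [/\ {homo f : i j / (i < j)%N}, {homo g : i j / (i < j)%N}
      & x = \det (mxsub f g A)].

Definition marked_ideal : Cring -> Prop :=
  ideal_gen (fun x : Cring =>
    exists (m : nat) (U : {vspace dhomog n.+1 K m}),
      homog_part J U /\ minor_of (marked_mx m) (\dim U).+1 x).

Definition lambda (c : Cvar) : 'rV[int]_n.+1 :=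
  \row_i ((val (tag c) i)%:Z - (nterm_mnm (tagged c) i)%:Z).

End MarkedScheme.

End MonomialIdeals.

Section Grading.

Variables (K : fieldType) (I : choiceType) (G : zmodType) (w : I -> G).

Definition mon_weight (mu : cmonom I) : G :=
  \sum_(c <- finsupp mu) w c *+ mu c.

Definition weight_part (g : G) (p : malg (cmonom I) K) :
    malg (cmonom I) K :=
  \sum_(mu <- monalg.msupp p | mon_weight mu == g)
     mkmalgU mu (monalg.mcoeff mu p).

Definition homogeneous_ideal (A : malg (cmonom I) K -> Prop) : Prop :=
  forall p, A p -> forall g, A (weight_part g p).

End Grading.

(* Main.v *)
Require Import Defs.
From HB Require Import structures.
From mathcomp Require Import all_boot all_order all_algebra perm finmap.
From mathcomp Require Import -(notations) monalg.
From mathcomp Require Import mpoly.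

(* Give the row x^delta F_alpha the weight delta + alpha and the column x^beta
   the weight beta. The entry of A_m there is 1 if beta = delta + alpha, and
   - C_(alpha gamma) if beta = delta + gamma, so it is lambda-homogeneous of
   degree the difference of the two weights. Hence in a minor every term of the
   Leibniz expansion has the same degree, and an ideal generated by homogeneous
   elements is homogeneous. *)

Set Implicit Arguments.
Unset Strict Implicit.
Unset Printing Implicit Defensive.

Import GRing.Theory.

Local Open Scope ring_scope.

Section Weights.

Variables (K : fieldType) (I : choiceType) (G : zmodType) (w : I -> G).

Local Notation A := (malg (cmonom I) K).

Implicit Types (mu nu : cmonom I) (p q : A) (g h : G).

(** Stated on the support, so that 0 is homogeneous of every degree; the zero entries of [A_m] then
    fit any prescribed weight. *)
Definition whomog g p : Prop :=
  forall mu, mu \in monalg.msupp p -> mon_weight w mu = g.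

(** Allows the weights of two monomials to be summed over one common index set, the support of their
    product. *)
Lemma mon_weightEw mu (d : {fset I}) : (finsupp mu `<=` d)%fset ->
  mon_weight w mu = \sum_(c <- d) w c *+ mu c.
Proof.
move=> le; rewrite /mon_weight (big_fset_incl _ le) // => c _.
by rewrite -cmE_neq0 negbK => /eqP ->.
Qed.

Lemma mon_weightM mu nu :
  mon_weight w (monalg.mmul mu nu) = mon_weight w mu + mon_weight w nu.
Proof.
rewrite (mon_weightEw (fsubsetUl (finsupp mu) (finsupp nu))).
rewrite (mon_weightEw (fsubsetUr (finsupp mu) (finsupp nu))) -big_split /=.
rewrite {1}/mon_weight mdomD.
by apply: eq_bigr => c _; rewrite cmM mulrnDr.
Qed.

Lemma mcoeff_weight_part g p mu :
  monalg.mcoeff mu (weight_part w g p) =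
  if mon_weight w mu == g then monalg.mcoeff mu p else 0.
Proof.
rewrite /weight_part raddf_sum /=.
under eq_bigr do rewrite monalg.mcoeffU.
have [pmu|pmu] := boolP (mu \in monalg.msupp p); last first.
  rewrite (monalg.mcoeff_outdom pmu) if_same big_seq_cond big1 // => nu.
  by case/andP=> pnu _; case: eqP pnu pmu => // -> ->.
rewrite big_mkcond (big_fsetD1 mu) //= eqxx mulr1n big1_fset ?addr0 // => nu.
by rewrite in_fsetD1 => /andP[/negPf-> _] _; rewrite if_same.
Qed.

Lemma weight_partD g p q :
  weight_part w g (p + q) = weight_part w g p + weight_part w g q.
Proof.
apply/monalg.malgP => mu.
rewrite monalg.mcoeffD [LHS]mcoeff_weight_part monalg.mcoeffD.
rewrite [X in _ = X + _]mcoeff_weight_part [X in _ = _ + X]mcoeff_weight_part.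
by case: ifP; rewrite ?addr0.
Qed.

Lemma weight_part0 g : weight_part w g (0 : A) = 0.
Proof.
apply/monalg.malgP => mu.
by rewrite [LHS]mcoeff_weight_part monalg.mcoeff0 if_same.
Qed.

(** Multiplication by [q] shifts every degree by [h]. The proof compares the coefficients of both
    convolution products. *)
Lemma weight_partM g h p q : whomog h q ->
  weight_part w g (p * q) = weight_part w (g - h) p * q.
Proof.
move=> hq; apply/monalg.malgP => mu.
rewrite [LHS]mcoeff_weight_part [X in if _ then X else _]monalg.mcoeffMl.
(* Both convolutions can then run over the support of [p]. *)
have le : (monalg.msupp (weight_part w (g - h) p) `<=` monalg.msupp p)%fset.
  apply/fsubsetP => nu; rewrite -!monalg.mcoeff_neq0 mcoeff_weight_part.
  by case: ifP; rewrite ?eqxx.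
rewrite (monalg.mcoeffMlw _ le (fsubset_refl _)).
(* If [k1 * k2 = mu], then [k1] has weight [g - h] exactly when [mu] has weight [g]: all
   contributions survive in the first case and none in the second. *)
case: ifP => eg.
  apply: eq_bigr => k1 _; rewrite !big_seq; apply: eq_bigr => k2 qk2.
  rewrite mcoeff_weight_part.
  case: (_ =P mu) => [e|//]; rewrite -e mon_weightM (hq _ qk2) in eg.
  by rewrite -(eqP eg) addrK eqxx.
rewrite big1 // => k1 _; rewrite big_seq big1 // => k2 qk2.
rewrite mcoeff_weight_part.
case: (_ =P mu) => [e|//]; rewrite -e mon_weightM (hq _ qk2) in eg.
by rewrite eq_sym subr_eq eq_sym eg mul0r.
Qed.

(** Taking the part of degree [g] only changes the cofactors: that of a generator of degree [h] is
    replaced by its part of degree [g - h]. *)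
Lemma homogeneous_ideal_gen (E : A -> Prop) :
  (forall q, E q -> exists h, whomog h q) ->
  homogeneous_ideal w (ideal_gen E).
Proof.
move=> hE p [s [sE ->]] g; elim: s sE => [_|u s IHs sE].
  by exists [::]; split=> //; rewrite !big_nil weight_part0.
have [v vs|t [tE et]] := IHs; first by apply: sE; rewrite inE vs orbT.
have [h hu] := hE _ (sE u (mem_head _ _)).
exists ((weight_part w (g - h) u.1, u.2) :: t); split=> [v|].
  by rewrite inE => /predU1P[-> /=|/tE //]; apply: sE; rewrite mem_head.
by rewrite !big_cons weight_partD et (weight_partM _ _ hu).
Qed.

Lemma whomog0 g : whomog g 0.
Proof. by move=> mu; rewrite monalg.msupp0. Qed.

Lemma whomogD g p q : whomog g p -> whomog g q -> whomog g (p + q).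
Proof.
move=> hp hq mu /(fsubsetP (monalg.msuppD_le _ _)).
by rewrite in_fsetU => /orP[/hp|/hq].
Qed.

Lemma whomogN g p : whomog g p -> whomog g (- p).
Proof. by move=> hp mu; rewrite monalg.msuppN => /hp. Qed.

Lemma whomog_sum (T : Type) (r : seq T) (P : pred T) (F : T -> A) g :
  (forall i, P i -> whomog g (F i)) -> whomog g (\sum_(i <- r | P i) F i).
Proof.
by move=> hF; apply: (big_ind (whomog g)) => //;
  [exact: whomog0 | exact: whomogD].
Qed.

Lemma whomog1 : whomog 0 1.
Proof.
move=> mu; rewrite monalg.msuppU1 in_fset1 => /eqP->.
by rewrite /mon_weight monalg.mdom1 big_seq_fset0.
Qed.

Lemma whomogM g h p q : whomog g p -> whomog h q -> whomog (g + h) (p * q).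
Proof.
move=> hp hq mu /monalg.msuppM_le [k1 [k2 [/hp <- /hq <- ->]]].
exact: mon_weightM.
Qed.

Lemma whomogU c : whomog (w c) (mkmalgU (ucm c) 1).
Proof.
move=> mu; rewrite monalg.msuppU1 in_fset1 => /eqP->.
by rewrite /mon_weight mdomU big_seq_fset1 cmUU.
Qed.

Lemma whomog_prod (T : Type) (r : seq T) (e : T -> G) (F : T -> A) :
  (forall i, whomog (e i) (F i)) ->
  whomog (\sum_(i <- r) e i) (\prod_(i <- r) F i).
Proof.
by move=> hF; apply: (big_ind2 whomog) => //;
  [exact: whomog1 | move=> g p h q; exact: whomogM].
Qed.

Lemma whomog_det k (B : 'M[A]_k) (r c : 'I_k -> G) :
  (forall i j, whomog (r i - c j) (B i j)) ->
  whomog (\sum_i r i - \sum_j c j) (\det B).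
Proof.
move=> hB; apply: whomog_sum => /= s _.
(* Reindexing the column weights by [s] shows that the degree of a Leibniz term does not depend on
   [s]. *)
have -> : \sum_i r i - \sum_j c j = \sum_i (r i - c (s i)).
  by rewrite sumrB [X in _ - X](reindex_perm s).
have := @whomog_prod _ (index_enum _) (fun i => r i - c (s i))
  (fun i => B i (s i)) (fun i => hB i (s i)).
by case: (odd_perm s); rewrite ?expr1 ?expr0 ?mul1r // mulN1r => /whomogN.
Qed.

End Weights.

Section Marked.

Variables (K : fieldType) (n : nat) (J : {pred {mpoly K[n.+1]}}).

(** Exponents are moved to integer vectors because weights get subtracted, and subtraction of
    multinomials is truncated. *)
Definition mnm_weight (a : 'X_{1..n.+1}) : 'rV[int]_n.+1 := \row_i (a i)%:Z.

Lemma mnm_weightD a b : mnm_weight (a + b) = mnm_weight a + mnm_weight b.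
Proof. by apply/rowP => i; rewrite !mxE mnmDE PoszD. Qed.

Lemma whomog_Cgen (c : Cvar J) :
  whomog (@lambda K n J)
    (mnm_weight (val (tag c)) - mnm_weight (nterm_mnm (tagged c))) (Cgen c).
Proof.
suff -> : mnm_weight (val (tag c)) - mnm_weight (nterm_mnm (tagged c))
          = lambda c by apply: whomogU.
by apply/rowP => i; rewrite !mxE.
Qed.

Lemma whomog_row m (u : marked_row J m) (b : 'X_{1..n.+1}) :
  whomog (@lambda K n J)
    (mnm_weight (bmnm (val u).1) + mnm_weight (bmnm (val (val u).2))
     - mnm_weight b)
    (marked_row_poly u)@_b.
Proof.
rewrite /marked_row_poly /marked mulrBr -mpolyXD mulr_sumr mcoeffB.
rewrite raddf_sum /= mcoeffX.
apply: whomogD; last apply/whomogN/whomog_sum => c _.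
  (* Leading term: a nonzero coefficient is 1, and the row and column weights cancel. *)
  case: eqP => [<-|_]; last exact: whomog0.
  by rewrite mnm_weightD subrr; apply: whomog1.
rewrite -scalerAr -mpolyXD mcoeffZ mcoeffX.
case: eqP => [<-|_]; last by rewrite mulr0; apply: whomog0.
rewrite mulr1 mnm_weightD.
(* The multiplier [x^delta] adds the same weight to row and column, leaving [alpha - gamma]. *)
rewrite opprD addrACA subrr add0r.
exact: whomog_Cgen.
Qed.

End Marked.

Theorem theorem4p5 (K : fieldType) (n : nat) (J : {pred {mpoly K[n.+1]}})
  (hJ : strongly_stable J) :
  homogeneous_ideal (@lambda K n J) (@marked_ideal K n J).
Proof.
apply: homogeneous_ideal_gen => _ [m [U [_ [f [g [_ _ ->]]]]]].
(* Weights of the rows and columns that the minor selects through [f] and [g]. *)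
pose r i := let u := val (enum_val (f i)) in
  mnm_weight (bmnm u.1) + mnm_weight (bmnm (val u.2)).
pose c j := mnm_weight (term_mnm (enum_val (g j))).
exists (\sum_i r i - \sum_j c j); apply: whomog_det => i j.
by rewrite !mxE; apply: whomog_row.
Qed.
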